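(* Let $\Lambda=\{\Lambda_i\}_{i\in I}$ be a g-frame for $\mathcal H$ with respect to $\{\mathcal K_i\}_{i\in I}$ with upper g-frame bound $B_\Lambda$, let $\Lambda^d=\{\Lambda^d_i\}_{i\in I}$ be a dual g-frame of $\Lambda$ with upper g-frame bound $B_{\Lambda^d}$, and let $U=\mathrm{diag}\{u_i\}_{i\in I}$ be a bounded diagonal operator on $\ell^2(\oplus_{i\in I}\mathcal K_i)$. Assume that $\Gamma=\{\Gamma_i\}_{i\in I}$ is a sequence of bounded operators $\Gamma_i\in B(\mathcal H,\mathcal K_i)$ which satisfies the following two conditions: 1. $\lambda:=\sum_{i\in I}\|\Lambda_i-\Gamma_i\|^2<\infty$; 2. $\mu:=\sum_{i\in I}\|\Lambda_i-u_i^*\Gamma_i\|\,\|\Lambda^d_i\|<1$. Let $M:=M_{U,\Gamma,\Lambda^d}$. Then $\Gamma$ is a g-frame for $\mathcal H$ with lower bound $\frac{1}{\|U\|^2B_{\Lambda^d}}(1-\mu)^2$ and upper bound $B_\Lambda\Big(1+\frac{\sqrt\lambda}{\sqrt{B_\Lambda}}\Big)^2$, the operator $M$ is invertible on $\mathcal H$, and for all $x\in\mathcal H$ $$\frac{1}{1+\mu}\|x\|\le\|M^{-1}x\|\le\frac{1}{1-\mu}\|x\|.$$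
   Context: $\mathcal H,\mathcal K$ are separable Hilbert spaces, $I\subseteq\mathbb Z$, and $\{\mathcal K_i\}_{i\in I}$ is a sequence of closed subspaces of $\mathcal K$. $\ell^2(\oplus_{i\in I}\mathcal K_i)$ is the Hilbert space of sequences $\{x_i\}_{i\in I}$ with $x_i\in\mathcal K_i$ and $\sum_i\|x_i\|^2<\infty$, with inner product $\langle\{x_i\},\{y_i\}\rangle=\sum_i\langle x_i,y_i\rangle$. A sequence $\Lambda=\{\Lambda_i\}_{i\in I}$ with $\Lambda_i\in B(\mathcal H,\mathcal K_i)$ is a g-frame for $\mathcal H$ with respect to $\{\mathcal K_i\}$ if there are constants $A_\Lambda,B_\Lambda>0$ (lower and upper g-frame bounds) with $A_\Lambda\|x\|^2\le\sum_{i}\|\Lambda_ix\|^2\le B_\Lambda\|x\|^2$ for all $x\in\mathcal H$; it is a g-Bessel sequence if only the upper inequality is required. For a g-Bessel sequence, $T_\Lambda:\ell^2(\oplus_i\mathcal K_i)\to\mathcal H$, $T_\Lambda\{x_i\}=\sum_i\Lambda_i^*x_i$, is the synthesis operator, with adjoint $T_\Lambda^*x=\{\Lambda_ix\}_{i\in I}$. A g-frame $\Lambda^d$ is a dual g-frame of $\Lambda$ if $x=\sum_i\Lambda_i^*\Lambda^d_ix$ for all $x\in\mathcal H$. $U=\mathrm{diag}\{u_i\}_{i\in I}$, $u_i\in B(\mathcal K_i)$, denotes the bounded operator $\{x_i\}\mapsto\{u_ix_i\}$ on $\ell^2(\oplus_i\mathcal K_i)$. For g-Bessel sequences $\Gamma,\Lambda^d$,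 the generalized multiplier is $M_{U,\Gamma,\Lambda^d}=T_\Gamma UT_{\Lambda^d}^*$, i.e. $M_{U,\Gamma,\Lambda^d}x=\sum_i\Gamma_i^*u_i\Lambda^d_ix$. ''Invertible'' means bijective with bounded inverse. *)

(* Defs.v *)
From HB Require Import structures.
From mathcomp Require Import all_boot all_order all_algebra.
From mathcomp Require Import sesquilinear complex.
From mathcomp Require Import all_classical all_reals all_analysis.

Set Implicit Arguments.
Unset Strict Implicit.
Unset Printing Implicit Defensive.

Import Order.TTheory GRing.Theory Num.Theory.
Import numFieldNormedType.Exports.

Local Open Scope classical_set_scope.
Local Open Scope ring_scope.

HB.mixin Record CompleteNormedModule_isHilbert (R : realType) V
    & CompleteNormedModule R[i] V := {
  dotp : {dot (V : lmodType R[i]) for Num.conj};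
  dotp_norm : forall x : V, dotp x x = `|x| ^+ 2
}.

#[short(type="hilbertType")]
HB.structure Definition Hilbert (R : realType) :=
  {V of CompleteNormedModule_isHilbert R V & CompleteNormedModule R[i] V}.

(* The library norm of a module over R[i] takes its values in R[i]. *)
Definition hnorm (R : realType) (E : hilbertType R) (x : E) : R :=
  complex.Re `|x|.

Definition separable (T : topologicalType) : Prop :=
  exists2 D : set T, countable D & dense D.

Section ClosedSubspace.
Variables (R : realType) (K : hilbertType R).

Record closedSubspace := ClosedSubspace {
  csub_set : set K;
  csub_submod : csub_set 0 /\
    forall (a : R[i]) x y, csub_set x -> csub_set y -> csub_set (a *: x + y);
  csub_closed : closed csub_set
}.

Definition csub_pred (W : closedSubspace) : {pred K} :=
  fun x => x \in csub_set W.

Variable W : closedSubspace.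

Lemma csub_predP x : reflect (csub_set W x) (x \in csub_pred W).
Proof. by apply: (iffP idP); [exact: set_mem|exact: mem_set]. Qed.

Lemma csub_submod_closed : subsemimod_closed (csub_pred W).
Proof.
have [W0 WD] := csub_submod W; split; first split.
- exact/csub_predP.
- move=> x y /csub_predP xW /csub_predP yW; apply/csub_predP.
  by rewrite -[x]scale1r; exact: WD.
- move=> a x /csub_predP xW; apply/csub_predP.
  by rewrite -[_ *: x]addr0; exact: WD.
Qed.

HB.instance Definition _ :=
  GRing.isSubmodClosed.Build _ _ (csub_pred W) csub_submod_closed.

Record csub_type := CSub { csub_val : K; csub_valP : csub_val \in csub_pred W }.

HB.instance Definition _ := [isSub of csub_type for csub_val].
HB.instance Definition _ := [Choice of csub_type by <:].
HB.instance Definition _ := [SubChoice_isSubLmodule of csub_type by <:].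

Let csub_norm (x : csub_type) : R[i] := `|csub_val x|.

Let csub_ler_normD x y : csub_norm (x + y) <= csub_norm x + csub_norm y.
Proof. exact: ler_normD. Qed.

Let csub_normrZ a x : csub_norm (a *: x) = `|a| * csub_norm x.
Proof. exact: normrZ. Qed.

Let csub_normr0_eq0 x : csub_norm x = 0 -> x = 0.
Proof. by move/normr0_eq0 => x0; exact: val_inj. Qed.

HB.instance Definition _ := @Lmodule_isNormed.Build _ csub_type
  csub_norm csub_ler_normD csub_normrZ csub_normr0_eq0.

Lemma csub_normE (x : csub_type) : `|x| = `|csub_val x|.
Proof. by []. Qed.

Let csub_complete (F : set_system csub_type) :
  ProperFilter F -> cauchy F -> cvg F.
Proof.
move=> FF /cauchyP Fc.
have GF : ProperFilter (csub_val @ F) by exact: fmap_proper_filter.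
have /cauchy_cvg /cvg_ex[/= l Fl] : cauchy (csub_val @ F).
  apply/cauchyP => e e0; have [x Fx] := Fc e e0.
  by exists (csub_val x); move: Fx; rewrite -!ball_normE.
have Wl : csub_set W l.
  apply: (@closed_cvg _ _ F _ csub_val (csub_set W)) Fl.
    exact: csub_closed.
  by apply: nearW => x; exact/csub_predP/csub_valP.
apply/cvg_ex; exists (CSub (introT (csub_predP _) Wl)).
apply/cvgrPdist_lt => e e0.
by move/cvgrPdist_lt : Fl => /(_ e e0).
Qed.

HB.instance Definition _ := Uniform_isComplete.Build csub_type csub_complete.

Definition csub_dot (x y : csub_type) : R[i] := dotp (csub_val x) (csub_val y).

Let csub_dot_bilinear :
  bilinear_for (GRing.Scale.Law.clone _ _ *%R _)
    (GRing.Scale.Law.clone _ _ (Num.conj \; *%R) _) csub_dot.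
Proof.
split=> z a x y; rewrite /csub_dot /=.
  by rewrite linearDl linearZl_LR.
by rewrite linearDr linearZr_LR.
Qed.

HB.instance Definition _ :=
  bilinear_isBilinear.Build _ _ _ _ _ _ csub_dot csub_dot_bilinear.

Let csub_dot_herm (x y : csub_type) :
  csub_dot x y = (-1) ^+ false * Num.conj (csub_dot y x).
Proof. exact: hermC. Qed.

HB.instance Definition _ :=
  isHermitianSesquilinear.Build _ _ _ _ csub_dot csub_dot_herm.

Let csub_dot_gt0 (x : csub_type) : x != 0 -> 0 < csub_dot x x.
Proof. by move=> x0; rewrite /csub_dot dotp_norm exprn_gt0// normr_gt0. Qed.

HB.instance Definition _ := isDotProduct.Build _ _ csub_dot csub_dot_gt0.

Let csub_dot_norm (x : csub_type) : csub_dot x x = `|x| ^+ 2.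
Proof. exact: dotp_norm. Qed.

HB.instance Definition _ :=
  CompleteNormedModule_isHilbert.Build R csub_type csub_dot_norm.

End ClosedSubspace.

Definition csub_hilbert (R : realType) (K : hilbertType R)
  (W : closedSubspace K) : hilbertType R := csub_type W.
Coercion csub_hilbert : closedSubspace >-> hilbertType.

Section Operators.
Variables (R : realType) (E F : hilbertType R).

Definition bounded_operator (T : E -> F) : Prop :=
  linear T /\ exists C : R, forall x, hnorm (T x) <= C * hnorm x.

Definition opnorm (T : E -> F) : R :=
  sup [set hnorm (T x) | x in [set x : E | hnorm x <= 1]].

(* [dotp] is linear in its first argument.  The vector chosen is unique, and
   it exists for every bounded T by the Riesz representation theorem. *)
Definition adjoint (T : E -> F) (y : F) : E :=
  xget 0 [set z | forall x, dotp (T x) y = dotp x z].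

End Operators.

Definition inverse_operator (R : realType) (E F : hilbertType R)
  (T : E -> F) (S : F -> E) : Prop :=
  [/\ cancel T S, cancel S T & bounded_operator S].

Section UnconditionalSum.
Variables (R : realType) (J : choiceType) (E : hilbertType R).

(* Sums over J are unconditional: limits of the sums over the finite subsets
   of J, directed by inclusion.  For g-Bessel families the series involved
   converge unconditionally, so no enumeration of J needs to be fixed. *)
Definition finite_subsets : set_system (set J) :=
  [set P | exists2 A, finite_set A &
     forall B, finite_set B -> A `<=` B -> P B].

Global Instance finite_subsets_filter : ProperFilter finite_subsets.
Proof.
split; first by move=> [A Afin /(_ A Afin)]; exact.
split.
- by exists set0.
- move=> P Q [A Afin PA] [B Bfin QB]; exists (A `|` B).
    by rewrite finite_setU.
  by move=> C Cfin; rewrite subUset => -[AC BC]; split; [exact: PA|exact: QB].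
- by move=> P Q PQ [A Afin PA]; exists A => // B Bfin AB; exact/PQ/PA.
Qed.

Definition has_sum (f : J -> E) (s : E) : Prop :=
  \sum_(j \in B) f j @[B --> finite_subsets] --> s.

Definition usum (f : J -> E) : E :=
  lim (\sum_(j \in B) f j @[B --> finite_subsets]).

End UnconditionalSum.

Section EllTwo.
Variables (R : realType) (J : choiceType) (K_ : J -> hilbertType R).

Definition ell2 (x : forall j, K_ j) : Prop :=
  (\esum_(j in [set: J]) (hnorm (x j) ^+ 2)%:E < +oo)%E.

Definition ell2_norm (x : forall j, K_ j) : R :=
  Num.sqrt (fine (\esum_(j in [set: J]) (hnorm (x j) ^+ 2)%:E)).

Definition diag (u : forall j, K_ j -> K_ j) (x : forall j, K_ j) :
  forall j, K_ j := fun j => u j (x j).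

Definition diag_bounded (u : forall j, K_ j -> K_ j) : Prop :=
  exists C : R, forall x, ell2 x ->
    ell2 (diag u x) /\ ell2_norm (diag u x) <= C * ell2_norm x.

Definition diag_norm (u : forall j, K_ j -> K_ j) : R :=
  sup [set ell2_norm (diag u x) | x in [set x | ell2 x /\ ell2_norm x <= 1]].

End EllTwo.

Section GFrames.
Variables (R : realType) (J : choiceType) (H : hilbertType R).
Variable K_ : J -> hilbertType R.
Implicit Types L Ld G : forall j, H -> K_ j.

Definition lower_gframe_bound L (A : R) : Prop :=
  0 < A /\ forall x, ((A * hnorm x ^+ 2)%:E <=
    \esum_(j in [set: J]) (hnorm (L j x) ^+ 2)%:E)%E.

Definition upper_gframe_bound L (B : R) : Prop :=
  0 < B /\ forall x, (\esum_(j in [set: J]) (hnorm (L j x) ^+ 2)%:E <=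
    (B * hnorm x ^+ 2)%:E)%E.

Definition gframe L : Prop :=
  [/\ forall j, bounded_operator (L j),
      exists A, lower_gframe_bound L A &
      exists B, upper_gframe_bound L B].

Definition dual_gframe L Ld : Prop :=
  gframe Ld /\ forall x, has_sum (fun j => adjoint (L j) (Ld j x)) x.

Definition synthesis G (x : forall j, K_ j) : H :=
  usum (fun j => adjoint (G j) (x j)).

(* The adjoint of the synthesis operator of L. *)
Definition analysis L (x : H) : forall j, K_ j := fun j => L j x.

Definition multiplier (u : forall j, K_ j -> K_ j) G Ld : H -> H :=
  fun x => synthesis G (diag u (analysis Ld x)).

End GFrames.

(* Main.v *)
(* Since x = sum_i Lambda_i^* Lambda^d_i x by duality, x - M x is the sum of
   (Lambda_i - u_i^* Gamma_i)^* Lambda^d_i x, whose norms are dominated by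
   |Lambda_i - u_i^* Gamma_i| |Lambda^d_i| |x|.  Hence |x - M x| <= mu |x|,
   which makes M invertible with the stated bounds.  Pairing with x,
   (1 - mu) |x|^2 <= Re <M x, x> = Re sum_i <u_i Lambda^d_i x, Gamma_i x>, and
   estimating the right-hand side by 2 Re <a, b> <= t |a|^2 + |b|^2 / t with the
   optimal t gives the lower bound of Gamma.  The upper bound is Minkowski's
   inequality for Gamma = Lambda - (Lambda - Gamma).  Adjoints exist by the
   Riesz theorem, obtained by minimizing |x|^2 - 2 Re f(x). *)

Require Import Defs.
From mathcomp Require Import all_boot all_order all_algebra.
From mathcomp Require Import complex finmap ring lra.
From mathcomp Require Import all_classical all_reals all_analysis.

Set Implicit Arguments.
Unset Strict Implicit.
Unset Printing Implicit Defensive.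

Import Order.TTheory GRing.Theory Num.Theory.
Import numFieldNormedType.Exports.

Local Open Scope classical_set_scope.
Local Open Scope ring_scope.

(** * Real parts, the real inner product and linear maps *)

Lemma ReMl (R : realType) (t : R) (a : R[i]) :
  complex.Re (t%:C%C * a) = t * complex.Re a.
Proof. by case: a => b c /=; rewrite mul0r subr0. Qed.

Lemma ReiM (R : realType) (a : R[i]) : complex.Re ('i%C * a) = - complex.Im a.
Proof. by case: a => b c /=; rewrite mul0r mul1r sub0r. Qed.

Lemma ReC (R : realType) (a : R[i]) : complex.Re (Num.conj a) = complex.Re a.
Proof. by case: a. Qed.

Section InnerProduct.
Variables (R : realType) (E : hilbertType R).
Implicit Types (x y z : E) (t : R).

(** Estimates are made with this symmetric real bilinear form, so that they live in the ordered
    field [R]; [dotp_rdot_ext] goes back to the complex form. *)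
Definition rdot x y : R := complex.Re (dotp x y).

Lemma hnormE x : `|x| = (hnorm x)%:C%C.
Proof. by rewrite /hnorm RRe_real. Qed.

Lemma rdotDl x y z : rdot (x + y) z = rdot x z + rdot y z.
Proof. by rewrite /rdot linearDl raddfD. Qed.

Lemma rdotNl x z : rdot (- x) z = - rdot x z.
Proof. by rewrite /rdot linearNl raddfN. Qed.

Lemma rdotZl t x z : rdot (t%:C%C *: x) z = t * rdot x z.
Proof. by rewrite /rdot linearZl_LR /= ReMl. Qed.

Lemma rdotC x y : rdot x y = rdot y x.
Proof. by rewrite /rdot hermC expr0 mul1r ReC. Qed.

Lemma rdotDr x y z : rdot x (y + z) = rdot x y + rdot x z.
Proof. by rewrite rdotC rdotDl !(rdotC x). Qed.

Lemma rdotNr x z : rdot x (- z) = - rdot x z.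
Proof. by rewrite rdotC rdotNl rdotC. Qed.

Lemma rdotZr t x z : rdot x (t%:C%C *: z) = t * rdot x z.
Proof. by rewrite rdotC rdotZl rdotC. Qed.

Lemma rdotxx x : rdot x x = hnorm x ^+ 2.
Proof. by rewrite /rdot dotp_norm hnormE -rmorphXn. Qed.

Lemma rdot_suml (J : Type) (s : seq J) (f : J -> E) z :
  rdot (\sum_(j <- s) f j) z = \sum_(j <- s) rdot (f j) z.
Proof.
elim/big_ind2: _ => //; first by rewrite /rdot linear0l.
by move=> a b c d <- <-; rewrite rdotDl.
Qed.

Lemma hnorm_ge0 x : 0 <= hnorm x.
Proof. by rewrite -ler0c -hnormE normr_ge0. Qed.

Lemma hnorm0 : hnorm (0 : E) = 0.
Proof. by rewrite /hnorm normr0. Qed.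

Lemma hnorm0_eq0 x : hnorm x = 0 -> x = 0.
Proof. by move=> x0; apply/normr0_eq0; rewrite hnormE x0. Qed.

Lemma hnorm_gt0 x : (0 < hnorm x) = (x != 0).
Proof. by rewrite -ltcR -hnormE normr_gt0. Qed.

Lemma hnormN x : hnorm (- x) = hnorm x.
Proof. by rewrite /hnorm normrN. Qed.

Lemma hnormBC x y : hnorm (x - y) = hnorm (y - x).
Proof. by rewrite -hnormN opprB. Qed.

Lemma ler_hnormD x y : hnorm (x + y) <= hnorm x + hnorm y.
Proof. by rewrite -lecR rmorphD/= -!hnormE ler_normD. Qed.

Lemma ler_hnormB x y : hnorm (x - y) <= hnorm x + hnorm y.
Proof. by rewrite -(hnormN y) ler_hnormD. Qed.

Lemma ler_hnorm_sum (J : Type) (s : seq J) (P : pred J) (f : J -> E) :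
  hnorm (\sum_(j <- s | P j) f j) <= \sum_(j <- s | P j) hnorm (f j).
Proof.
elim/big_ind2: _ => //; first by rewrite hnorm0.
by move=> a b c d ab cd; apply: (le_trans (ler_hnormD _ _)); exact: lerD.
Qed.

Lemma hnormZ (a : R[i]) x : hnorm (a *: x) = complex.Re `|a| * hnorm x.
Proof.
by rewrite {1}/hnorm normrZ hnormE mulrC ReMl mulrC.
Qed.

Lemma hnormZR t x : hnorm (t%:C%C *: x) = `|t| * hnorm x.
Proof. by rewrite hnormZ normc_def /= expr0n addr0 sqrtr_sqr. Qed.

Lemma hnormD_sqr x y :
  hnorm (x + y) ^+ 2 = hnorm x ^+ 2 + 2 * rdot x y + hnorm y ^+ 2.
Proof. by rewrite -!rdotxx !rdotDl !rdotDr (rdotC y x); ring. Qed.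

(** Cauchy-Schwarz: the vector |y| x - |x| y has squared norm 2 |x| |y| (|x| |y| - Re <x, y>). *)
Lemma rdot_le x y : rdot x y <= hnorm x * hnorm y.
Proof.
have [->|] := eqVneq x 0; first by rewrite /rdot linear0l hnorm0 mul0r.
have [->|] := eqVneq y 0; first by rewrite rdotC /rdot linear0l hnorm0 mulr0.
rewrite -!hnorm_gt0 => y0 x0.
have := sqr_ge0 (hnorm ((hnorm y)%:C%C *: x + (- hnorm x)%:C%C *: y)).
rewrite hnormD_sqr !hnormZR rdotZl rdotZr normrN !gtr0_norm// => ge0.
have xy0 : 0 < hnorm x * hnorm y by rewrite mulr_gt0.
rewrite -(ler_pM2l xy0); lra.
Qed.

(** Expand the nonnegative square |t x - y|^2 and divide by t. *)
Lemma rdot_AMGM t x y :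
  0 < t -> 2 * rdot x y <= t * hnorm x ^+ 2 + t^-1 * hnorm y ^+ 2.
Proof.
move=> t0; have := sqr_ge0 (hnorm (t%:C%C *: x - y)).
rewrite hnormD_sqr rdotZl rdotNr hnormN hnormZR gtr0_norm// => h.
rewrite -subr_ge0 -(pmulr_rge0 _ t0).
apply: (le_trans h); rewrite le_eqVlt; apply/orP; left; apply/eqP.
by field; rewrite gt_eqF.
Qed.

End InnerProduct.

Section LinearTheory.
Variables (R : realType) (E F : hilbertType R) (T : E -> F).
Hypothesis Tl : linear T.

Lemma lin0 : T 0 = 0.
Proof.
have /eqP := Tl 1 0 0.
by rewrite !scale1r addr0 -subr_eq subrr eq_sym => /eqP.
Qed.

Lemma linZ a x : T (a *: x) = a *: T x.
Proof. by rewrite -[a *: x]addr0 Tl lin0 addr0. Qed.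

Lemma linD x y : T (x + y) = T x + T y.
Proof. by rewrite -{1}[x]scale1r Tl scale1r. Qed.

Lemma linB x y : T (x - y) = T x - T y.
Proof. by rewrite -scaleN1r linD linZ scaleN1r. Qed.

End LinearTheory.

(** Replacing x by i x turns the equality of real parts into that of imaginary parts. *)
Lemma dotp_rdot_ext (R : realType) (E F : hilbertType R) (T : E -> F) z w :
  linear T -> (forall x, rdot (T x) w = rdot x z) ->
  forall x, dotp (T x) w = dotp x z.
Proof.
move=> Tl Tz x; apply/eqP; rewrite eq_complex; apply/andP; split.
  exact/eqP/Tz.
have := Tz ('i%C *: x); rewrite /rdot linZ// !linearZl_LR /= !ReiM.
by move/oppr_inj ->.
Qed.

Lemma dotp_inj (R : realType) (E : hilbertType R) (y z : E) :
  (forall x, dotp x y = dotp x z) -> y = z.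
Proof.
move=> yz; apply/eqP; rewrite -subr_eq0; apply/eqP/hnorm0_eq0/eqP.
by rewrite -sqrf_eq0 -rdotxx /rdot linearBr/= yz subrr.
Qed.

(** * Minimization in a Hilbert space and the Riesz representation theorem *)

Lemma posc (R : realType) (e : R[i]) :
  0 < e -> exists2 r : R, 0 < r & e = r%:C%C.
Proof.
move=> e0; have eE : e = (complex.Re e)%:C%C by rewrite RRe_real// gtr0_real.
by exists (complex.Re e) => //; rewrite -ltcR -eE.
Qed.

(* The sublevel sets of g generate a Cauchy filter. *)
Lemma complete_minimizer (R : realType) (E : hilbertType R) (g : E -> R) :
  (forall e : R, 0 < e -> exists x, g x < e) ->
  (forall e : R, 0 < e -> exists2 d, 0 < d &
     forall x y, g x < d -> g y < d -> hnorm (x - y) < e) ->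
  (forall z (e : R), 0 < e -> exists2 d, 0 < d &
     forall x, hnorm (z - x) < d -> g z < g x + e) ->
  exists z, g z <= 0.
Proof.
move=> g_inf g_cauchy g_lsc.
pose F : set_system E :=
  [set P | exists2 e, 0 < e & forall x, g x < e -> P x].
have FF : ProperFilter F.
  split; first by move=> [e /g_inf[x gx]] /(_ x gx).
  split.
  - by exists 1.
  - move=> P Q [d d0 dP] [e e0 eQ]; exists (Num.min d e).
      by rewrite lt_min d0.
    by move=> x; rewrite lt_min => /andP[xd xe]; split; [exact: dP|exact: eQ].
  - by move=> P Q PQ [d d0 dP]; exists d => // x /dP /PQ.
have /cauchy_cvg /cvg_ex[/= z Fz] : cauchy F.
  apply/cauchyP => _ /posc[e e0 ->]; have [d d0 gd] := g_cauchy e e0.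
  have [x gx] := g_inf d d0; exists x; exists d => // y gy.
  by rewrite -ball_normE /ball_/= hnormE ltcR; exact: gd.
exists z; apply/ler_addgt0Pr => e e0; rewrite add0r.
have e20 : 0 < e / 2 by rewrite divr_gt0.
have [d d0 gd] := g_lsc z (e / 2) e20.
have Fd : F (ball z d%:C%C) by apply: Fz; apply: nbhsx_ballx; rewrite ltcR.
have Fe : F [set x | g x < e / 2] by exists (e / 2).
have [x [xz gx]] := filter_ex (filterI Fd Fe).
move: xz; rewrite -ball_normE /ball_/= hnormE ltcR => /gd.
by move/ltW => /le_trans; apply; move: gx => /=; lra.
Qed.

(** The representing vector is the minimizer of q(x) = |x|^2 - 2 f(x), where the derivative of q
    vanishes in every direction. Only real homogeneity is asked of f, since it will be the real part
    of a complex functional. *)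
Lemma riesz (R : realType) (E : hilbertType R) (f : E -> R) (C : R) :
  (forall x y, f (x + y) = f x + f y) ->
  (forall t x, f (t%:C%C *: x) = t * f x) ->
  (forall x, f x <= C * hnorm x) ->
  exists z, forall x, f x = rdot x z.
Proof.
move=> fD fZ fC0; wlog C0 : C fC0 / 0 <= C.
  move=> /(_ `|C|); apply => // x; apply: (le_trans (fC0 x)).
  by rewrite ler_wpM2r ?hnorm_ge0 ?ler_norm.
pose q x := hnorm x ^+ 2 - 2 * f x.
have qD x y : q (x + y) = q x + 2 * rdot x y + hnorm y ^+ 2 - 2 * f y.
  by rewrite /q hnormD_sqr fD; ring.
have q_inf : has_inf (range q).
  split; first by exists (q 0), 0.
  (* Completing the square: |x|^2 - 2 C |x| >= - C^2. *)
  exists (- C ^+ 2) => _ [x _ <-]; rewrite /q.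
  have := fC0 x; have := sqr_ge0 (hnorm x - C).
  rewrite (_ : (_ - _) ^+ 2 = hnorm x ^+ 2 - 2 * (C * hnorm x) + C ^+ 2).
    by lra.
  by ring.
have q_ge x : inf (range q) <= q x.
  by apply: ge_inf; [case: q_inf|exists x].
have [|||z qz] := @complete_minimizer R E (fun x => q x - inf (range q)).
- move=> e e0; have [_ [x _ <-] qx] := inf_adherent e0 q_inf.
  by exists x; lra.
(* By the parallelogram law |x - y|^2 / 2 = q x + q y - 2 q ((x + y) / 2), which is below 2 (e^2 /
   4) when x and y are that close to the infimum. *)
- move=> e e0; exists (e ^+ 2 / 4); first by rewrite divr_gt0 ?exprn_gt0.
  move=> x y qx qy; rewrite -(ltr_pXn2r (n := 2))// ?nnegrE ?hnorm_ge0 ?(ltW e0)//.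
  have := q_ge (2^-1%:C%C *: (x + y)).
  rewrite /q hnormZR fZ fD exprMn real_normK ?num_real// hnormD_sqr.
  move: qx qy; rewrite /q hnormD_sqr rdotNr hnormN; lra.
(* Expanding q around z gives q z - q x <= (2 |z| + 2 C) |x - z|; the added 1 makes [k] positive. *)
- move=> z e e0; pose k := 2 * hnorm z + 2 * C + 1.
  have k0 : 0 < k by rewrite /k; have := hnorm_ge0 z; lra.
  exists (e / k) => [|x]; first by rewrite divr_gt0.
  rewrite ltr_pdivlMr// hnormBC => xz; suff : q z < q x + e by lra.
  have -> : q x = q (z + (x - z)) by rewrite addrC subrK.
  rewrite qD; have := fC0 (x - z); have := rdot_le z (z - x).
  rewrite -[z - x]opprB rdotNr hnormN => h1 h2.
  have := sqr_ge0 (hnorm (x - z)); have := hnorm_ge0 (x - z).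
  move: xz; rewrite /k !mulrDr mulr1; lra.
exists z => y; apply/esym/eqP; rewrite -subr_eq0 rdotC.
set c := _ - _; pose n := hnorm y ^+ 2.
have n0 : 0 <= n by exact: sqr_ge0.
(* Moving from z by s y changes q by 2 s c + s^2 n. The choice s = - c / (n + 1) makes this a
   negative multiple of c^2, so c = 0; the denominator n + 1 also covers y = 0. *)
have := q_ge (z + (- c / (n + 1))%:C%C *: y).
rewrite qD rdotZr hnormZR fZ exprMn real_normK ?num_real// => h.
have {h}: 0 <= (- c / (n + 1)) * 2 * c + (- c / (n + 1)) ^+ 2 * n.
  by move: h qz; rewrite /c -/n; lra.
have -> : (- c / (n + 1)) * 2 * c + (- c / (n + 1)) ^+ 2 * n =
    - (c ^+ 2 * ((n + 2) / (n + 1) ^+ 2)) by field; lra.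
rewrite oppr_ge0 => h; rewrite -sqrf_eq0 eq_le sqr_ge0 andbT.
by move: h; rewrite pmulr_lle0// divr_gt0// ?exprn_gt0//; lra.
Qed.

(** * Adjoints and operator norms *)

Lemma dotpPr (R : realType) (E : hilbertType R) (a : R[i]) (x y z : E) :
  dotp x (a *: y + z) = Num.conj a * dotp x y + dotp x z.
Proof. by rewrite linearDr linearZr_LR. Qed.

Section Adjoint.
Variables (R : realType) (E F : hilbertType R) (T : E -> F).
Hypothesis Tb : bounded_operator T.

(** Riesz applied to x |-> Re <T x, y> provides a candidate, so the [xget] in [adjoint] does not
    fall back on its default 0. *)
Lemma dotp_adjoint x y : dotp (T x) y = dotp x (adjoint T y).
Proof.
have [Tl [C TC]] := Tb.
have [|||z Tz] := @riesz R E (fun x => rdot (T x) y) (C * hnorm y).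
- by move=> a b; rewrite linD// rdotDl.
- by move=> t a; rewrite linZ// rdotZl.
- move=> a; apply: (le_trans (rdot_le _ _)).
  by rewrite mulrAC ler_wpM2r ?hnorm_ge0.
rewrite /adjoint.
have := @xgetI _ 0 [set z | forall x, dotp (T x) y = dotp x z] z.
by apply; exact: dotp_rdot_ext.
Qed.

Lemma rdot_adjoint x y : rdot (T x) y = rdot x (adjoint T y).
Proof. by rewrite /rdot dotp_adjoint. Qed.

Lemma adjoint_linear : linear (adjoint T).
Proof.
move=> a y z; apply: dotp_inj => x.
by rewrite -dotp_adjoint !dotpPr !dotp_adjoint.
Qed.

End Adjoint.

Section OperatorNorm.
Variables (R : realType) (E F : hilbertType R) (T : E -> F).
Hypothesis Tb : bounded_operator T.

Let opnorm_has_sup :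
  has_sup [set hnorm (T x) | x in [set x : E | hnorm x <= 1]].
Proof.
split; first by exists (hnorm (T 0)), 0 => //=; rewrite hnorm0 ler01.
have [_ [C TC]] := Tb; exists `|C| => _ [x /= x1 <-].
apply: (le_trans (TC x)); apply: (le_trans (ler_norm _)).
by rewrite normrM ler_piMr// ger0_norm ?hnorm_ge0.
Qed.

Lemma opnorm_ge0 : 0 <= opnorm T.
Proof.
apply: (le_trans (hnorm_ge0 (T 0))); apply: ub_le_sup.
  by case: opnorm_has_sup.
by exists 0 => //=; rewrite hnorm0 ler01.
Qed.

Lemma ler_opnorm x : hnorm (T x) <= opnorm T * hnorm x.
Proof.
have [Tl _] := Tb.
have [->|] := eqVneq x 0; first by rewrite lin0// !hnorm0 mulr0.
rewrite -hnorm_gt0 => x0; rewrite -ler_pdivrMr//.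
apply: ub_le_sup; first by case: opnorm_has_sup.
exists ((hnorm x)^-1%:C%C *: x).
  by rewrite /= hnormZR gtr0_norm ?invr_gt0// mulVf// gt_eqF.
by rewrite linZ// hnormZR gtr0_norm ?invr_gt0// mulrC.
Qed.

End OperatorNorm.

Lemma bounded_operatorB (R : realType) (E F : hilbertType R) (S T : E -> F) :
  bounded_operator S -> bounded_operator T ->
  bounded_operator (fun x => S x - T x).
Proof.
move=> [Sl [C SC]] [Tl [D TD]]; split.
  by move=> a x y; rewrite Sl Tl scalerBr opprD addrACA.
exists (C + D) => x; apply: (le_trans (ler_hnormB _ _)).
by rewrite mulrDl lerD.
Qed.

Lemma bounded_operator_comp (R : realType) (E F G : hilbertType R)
    (S : F -> G) (T : E -> F) :
  bounded_operator S -> bounded_operator T ->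
  bounded_operator (S \o T).
Proof.
move=> Sb Tb; have [Sl _] := Sb; have [Tl _] := Tb; split.
  by move=> a x y /=; rewrite Tl Sl.
exists (opnorm S * opnorm T) => x /=.
apply: (le_trans (ler_opnorm Sb _)); rewrite -mulrA.
by rewrite ler_wpM2l ?opnorm_ge0// ler_opnorm.
Qed.

(** Test z = T^* y against itself: |z|^2 = Re <T z, y> <= |T| |z| |y|, then cancel |z|. *)
Lemma adjoint_bounded (R : realType) (E F : hilbertType R) (T : E -> F) :
  bounded_operator T -> bounded_operator (adjoint T).
Proof.
move=> Tb; split; first exact: adjoint_linear.
exists (opnorm T) => y; set z := adjoint T y.
have [->|] := eqVneq z 0; first by rewrite hnorm0 mulr_ge0 ?opnorm_ge0 ?hnorm_ge0.
rewrite -hnorm_gt0 => z0; rewrite -(ler_pM2r z0) -expr2 -rdotxx -rdot_adjoint//.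
apply: (le_trans (rdot_le _ _)); rewrite mulrAC ler_wpM2r ?hnorm_ge0//.
exact: ler_opnorm.
Qed.

(** * Finite partial sums, the ell2 norm and unconditional convergence *)

Section FiniteSums.
Variables (R : realType) (J : choiceType).

Lemma esum_leP (a : J -> R) (c : R) :
  (\esum_(j in [set: J]) (a j)%:E <= c%:E)%E <->
  forall B : {fset J}, \sum_(j <- B) a j <= c.
Proof.
split=> [ac B|ac].
  rewrite -lee_fin; apply: le_trans ac; apply: ereal_sup_ubound.
  exists [set` B] => //; rewrite fsbig_finite//= set_fsetK.
  by rewrite sumEFin.
apply: ge_ereal_sup => _ [A [Afin _] <-].
by rewrite fsumEFin// lee_fin fsbig_finite.
Qed.

Lemma ell2_norm_ge0 (K_ : J -> hilbertType R) (x : forall j, K_ j) :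
  0 <= ell2_norm x.
Proof. exact: sqrtr_ge0. Qed.

(** Since [fine] sends an infinite sum to 0, a bound on [ell2_norm] is informative only together
    with membership in [ell2]; hence the conjunction. *)
Lemma ell2_leP (K_ : J -> hilbertType R) (x : forall j, K_ j) (c : R) :
  0 <= c ->
  (ell2 x /\ ell2_norm x <= c) <->
  forall B : {fset J}, \sum_(j <- B) hnorm (x j) ^+ 2 <= c ^+ 2.
Proof.
move=> c0; rewrite -esum_leP /ell2 /ell2_norm.
have : (0 <= \esum_(j in [set: J]) (hnorm (x j) ^+ 2)%:E)%E.
  by apply: esum_ge0 => j _; rewrite lee_fin sqr_ge0.
case: esum => [r||] //; last by split=> [[]|].
rewrite !lee_fin ltry /= => r0; rewrite -[in X in _ <-> X](sqr_sqrtr r0).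
rewrite ler_pXn2r ?nnegrE ?sqrtr_ge0//.
by split=> [[]|].
Qed.

Lemma ell2_sum_le (K_ : J -> hilbertType R) (x : forall j, K_ j)
    (B : {fset J}) :
  ell2 x -> \sum_(j <- B) hnorm (x j) ^+ 2 <= ell2_norm x ^+ 2.
Proof.
by move=> x2; apply: (proj1 (ell2_leP x (sqrtr_ge0 _))); split.
Qed.

Section Unconditional.
Variable E : hilbertType R.
Implicit Types f g : J -> E.

Lemma fset_finite_subsets (P : set (set J)) (A : {fset J}) :
  (forall B : {fset J}, (A `<=` B)%fset -> P [set` B]) -> finite_subsets P.
Proof.
move=> AP; exists [set` A] => // B Bfin AB.
rewrite -(fset_setK Bfin); apply: AP.
by rewrite -(set_fsetK A) -fset_set_sub.
Qed.

Lemma has_sumP f s :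
  has_sum f s <-> forall e : R, 0 < e -> exists A : {fset J},
    forall B : {fset J}, (A `<=` B)%fset -> hnorm (s - \sum_(j <- B) f j) < e.
Proof.
rewrite /has_sum; split.
  move=> /cvgrPdist_lt fs e e0.
  have [|A Afin AB] := fs e%:C%C; first by rewrite ltcR.
  exists (fset_set A) => B AsubB; rewrite -ltcR -hnormE.
  have := AB [set` B] (finite_fset _); rewrite fsbig_finite//= set_fsetK.
  by apply; rewrite -(fset_setK Afin); exact/fsubsetP.
move=> fs; apply/cvgrPdist_lt => _ /posc[e e0 ->].
have [A AB] := fs e e0; apply: (@fset_finite_subsets _ A) => B /AB.
by rewrite /= hnormE ltcR fsbig_finite//= set_fsetK.
Qed.

Lemma has_sum_usum f s : has_sum f s -> usum f = s.
Proof. by apply: cvg_lim; exact: norm_hausdorff. Qed.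

Lemma has_sum_linear (a : R[i]) f g s t : has_sum f s -> has_sum g t ->
  has_sum (fun j => a *: f j + g j) (a *: s + t).
Proof.
move=> /has_sumP fs /has_sumP gt; apply/has_sumP => e e0.
pose k := complex.Re `|a|; have k0 : 0 <= k.
  by rewrite -lecR RRe_real ?normr_real ?normr_ge0.
(* Dividing by k + 1 instead of k allows a = 0. *)
have [|A Af] := fs (e / 2 / (k + 1)); first by rewrite !divr_gt0// ltr_wpDl.
have [|B Bg] := gt (e / 2); first by rewrite divr_gt0.
exists (A `|` B)%fset => C; rewrite fsubUset => /andP[/Af fC /Bg gC].
rewrite big_split/= -scaler_sumr opprD addrACA -scalerBr.
apply: (le_lt_trans (ler_hnormD _ _)); rewrite hnormZ -/k.
rewrite [e in _ < e](_ : e = e / 2 + e / 2); last by field.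
apply: ler_ltD => //; move: fC; rewrite ltr_pdivlMr ?ltr_wpDl// => fC.
by apply: le_trans (ltW fC); rewrite mulrC ler_wpM2l ?hnorm_ge0// lerDl.
Qed.

(** Passage to the limit for Lipschitz functionals; it serves for the norm and for y |-> 2 Re <y,
    x>. *)
Lemma has_sum_le f s (F : E -> R) (k c : R) :
  has_sum f s -> 0 <= k -> (forall x y, F x <= F y + k * hnorm (x - y)) ->
  (forall B : {fset J}, F (\sum_(j <- B) f j) <= c) -> F s <= c.
Proof.
move=> /has_sumP fs k0 FL Fc; apply/ler_addgt0Pr => e e0.
have k1 : 0 < k + 1 by rewrite ltr_wpDl.
have [|A /(_ A (fsubset_refl _))] := fs (e / (k + 1)).
  by rewrite divr_gt0.
rewrite ltr_pdivlMr// => sA; apply: (le_trans (FL _ (\sum_(j <- A) f j))).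
apply: lerD; first exact: Fc.
by apply: le_trans (ltW sA); rewrite mulrC ler_wpM2l ?hnorm_ge0// lerDl.
Qed.

(** If the sum of c over a finite A is within e of the supremum of all finite sums, then enlarging A
    adds less than e to it. So the partial sums of f are Cauchy. *)
Lemma has_sum_absolute f (c : J -> R) (m : R) :
  (forall j, hnorm (f j) <= c j) ->
  (forall B : {fset J}, \sum_(j <- B) c j <= m) ->
  exists2 s, has_sum f s & hnorm s <= m.
Proof.
move=> fc cm.
have c0 j : 0 <= c j by apply: le_trans (fc j); exact: hnorm_ge0.
pose S := [set \sum_(j <- B) c j | B in [set: {fset J}]].
have S_sup : has_sup S.
  by split; [exists (\sum_(j <- fset0) c j), fset0|exists m => _ [B _ <-]].
pose G := (fun B : set J => \sum_(j <- fset_set B) f j) @ @finite_subsets J.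
have GF : ProperFilter G by exact: fmap_proper_filter.
have /cauchy_cvg /cvg_ex[/= s Gs] : cauchy G.
  apply/cauchyP => _ /posc[e e0 ->].
  have [_ [A _ <-] cA] := sup_adherent e0 S_sup.
  exists (\sum_(j <- A) f j); apply: (@fset_finite_subsets _ A) => B AB.
  rewrite -ball_normE /ball_/= hnormE ltcR set_fsetK hnormBC.
  (* Stated for a general codomain because the splitting is used for the vectors f and for the reals
     c. *)
  have BE (V : nmodType) (h : J -> V) : \sum_(j <- B) h j =
      \sum_(j <- A) h j + \sum_(j <- B | j \notin A) h j.
    have AE : A = [fset j in B | mem A j]%fset.
      apply/fsetP => j; rewrite !inE /= andbC.
      by have [/(fsubsetP AB) ->|] := boolP (j \in A).
    rewrite (big_fsetID _ (mem A)) [in X in _ + X = _]big_fset /=.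
    by congr (_ + _); rewrite [in RHS]AE.
  rewrite BE addrC addKr; apply: (le_lt_trans (ler_hnorm_sum _ _ _)).
  apply: (@le_lt_trans _ _ (\sum_(j <- B | j \notin A) c j)).
    exact: ler_sum.
  have : \sum_(j <- B) c j <= sup S.
    by apply: ub_le_sup; [case: S_sup|exists B].
  by rewrite BE => BS; lra.
have fs : has_sum f s.
  apply/has_sumP => e e0; have e0' : 0 < e%:C%C by rewrite ltcR.
  move/cvgrPdist_lt: Gs => /(_ _ e0')[A Afin AB].
  exists (fset_set A) => B AsubB; rewrite -ltcR -hnormE.
  have := AB [set` B] (finite_fset _); rewrite /= set_fsetK.
  by apply; rewrite -(fset_setK Afin); exact/fsubsetP.
exists s => //; apply: (@has_sum_le _ _ (@hnorm R E) _ _ fs ler01) => [x y|B].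
  by rewrite mul1r -{1}[x](subrK y) addrC ler_hnormD.
by apply: le_trans (cm B); apply: (le_trans (ler_hnorm_sum _ _ _)); exact: ler_sum.
Qed.

End Unconditional.

End FiniteSums.

(** * The norm of a diagonal operator *)

Section DiagonalOperator.
Variables (R : realType) (J : choiceType) (K_ : J -> hilbertType R).
Variable u : forall j, K_ j -> K_ j.
Hypothesis u_linear : forall j, linear (@u j).
Hypothesis U_bounded : diag_bounded u.

Let diag_has_sup :
  has_sup [set ell2_norm (diag u x) | x in [set x | ell2 x /\ ell2_norm x <= 1]].
Proof.
split.
  exists (ell2_norm (diag u (fun j => 0))), (fun j => 0) => //=.
  apply/ell2_leP; first exact: ler01.
  by move=> B; rewrite big1 ?expr1n ?ler01// => j _; rewrite hnorm0 expr0n.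
have [C UC] := U_bounded; exists `|C| => _ [x /= [x2 x1] <-].
have [_ Ux] := UC x x2; apply: (le_trans Ux); apply: (le_trans (ler_norm _)).
by rewrite normrM ler_piMr// ger0_norm ?ell2_norm_ge0.
Qed.

Lemma diag_norm_ge0 : 0 <= diag_norm u.
Proof.
have [[_ [x x1 _]] ub] := diag_has_sup.
apply: (le_trans (ell2_norm_ge0 _)).
by apply: (ub_le_sup ub); exists x.
Qed.

(** By homogeneity: x / c lies in the unit ball over which [diag_norm] is a supremum. *)
Lemma diag_sum_le (x : forall j, K_ j) (c : R) (B : {fset J}) :
  0 <= c -> ell2 x -> ell2_norm x <= c ->
  \sum_(j <- B) hnorm (u (x j)) ^+ 2 <= (diag_norm u * c) ^+ 2.
Proof.
move=> c0 x2 xc.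
have [C UC] := U_bounded.
(* For c = 0 rescaling is impossible; then x has norm 0 and any bound C of the operator gives |U x|
   <= C * 0. *)
move: c0; rewrite le_eqVlt => /orP[/eqP c0|c0].
  have [Ux2 Ux] := UC x x2.
  apply: (le_trans (ell2_sum_le _ Ux2)).
  have x0 : ell2_norm x = 0 by apply/eqP; rewrite eq_le {1}c0 xc ell2_norm_ge0.
  rewrite -c0 mulr0; rewrite x0 mulr0 in Ux.
  by rewrite ler_pXn2r ?nnegrE ?ell2_norm_ge0.
pose y : forall j, K_ j := fun j => c^-1%:C%C *: x j.
have ci0 : 0 < c^-1 by rewrite invr_gt0.
have [y2 y1] : ell2 y /\ ell2_norm y <= 1.
  apply/ell2_leP => // A; rewrite expr1n.
  under eq_bigr do rewrite hnormZR exprMn gtr0_norm//.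
  rewrite -mulr_sumr exprVn ler_pdivrMl ?exprn_gt0// mulr1.
  apply: (le_trans (ell2_sum_le _ x2)).
  by rewrite ler_pXn2r ?nnegrE ?ell2_norm_ge0// ltW.
have [Uy2 _] := UC y y2.
have Uy : ell2_norm (diag u y) <= diag_norm u.
  by apply: ub_le_sup; [case: diag_has_sup|exists y].
have : \sum_(j <- B) hnorm (diag u y j) ^+ 2 <= diag_norm u ^+ 2.
  apply: (le_trans (ell2_sum_le _ Uy2)).
  by rewrite ler_pXn2r ?nnegrE ?ell2_norm_ge0// diag_norm_ge0.
rewrite /diag /y; under eq_bigr do rewrite linZ// hnormZR exprMn gtr0_norm//.
by rewrite -mulr_sumr exprVn ler_pdivrMl ?exprn_gt0// -exprMn mulrC.
Qed.

End DiagonalOperator.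

(** With D = S - v^* T, the vector e on the left is D^* w, and |e|^2 = Re <D e, w> <= |D| |e| |w|.
    This is how the operators in the definition of mu enter the estimates. *)
Lemma ler_hnorm_adjointB (R : realType) (E F : hilbertType R) (S T : E -> F)
    (v : F -> F) (w : F) :
  bounded_operator S -> bounded_operator T -> bounded_operator v ->
  hnorm (adjoint S w - adjoint T (v w)) <=
    opnorm (fun x => S x - adjoint v (T x)) * hnorm w.
Proof.
move=> Sb Tb vb; set e := adjoint S w - _; set D := fun x => _.
have Db : bounded_operator D.
  apply: bounded_operatorB => //.
  by apply: bounded_operator_comp => //; exact: adjoint_bounded.
have [->|] := eqVneq e 0.
  by rewrite hnorm0 mulr_ge0 ?opnorm_ge0 ?hnorm_ge0.
rewrite -hnorm_gt0 => e0; rewrite -(ler_pM2r e0) -expr2 -rdotxx.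
have -> : rdot e e = rdot (D e) w.
  rewrite {2}/e rdotDr rdotNr -!rdot_adjoint// /D rdotDl rdotNl.
  by rewrite (rdotC _ (v w)) (rdot_adjoint vb) (rdotC w).
apply: (le_trans (rdot_le _ _)); rewrite mulrAC ler_wpM2r ?hnorm_ge0//.
exact: ler_opnorm.
Qed.

(** * Inverting an operator close to the identity *)

Section NearIdentity.
Variables (R : realType) (H : hilbertType R) (M : H -> H) (mu : R).
Hypothesis M_linear : linear M.
Hypothesis mu_lt1 : mu < 1.
Hypothesis mu_ge0 : 0 <= mu.
Hypothesis M_near : forall x, hnorm (x - M x) <= mu * hnorm x.

Lemma near_identity_le x : hnorm (M x) <= (1 + mu) * hnorm x.
Proof.
rewrite -[M x](subKr x); apply: (le_trans (ler_hnormB _ _)).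
by rewrite mulrDl mul1r lerD2l.
Qed.

Lemma near_identity_ge x : (1 - mu) * hnorm x <= hnorm (M x).
Proof.
have := ler_hnormD (x - M x) (M x); rewrite subrK.
by have := M_near x; lra.
Qed.

(** Adding the residual y - M x to x multiplies its norm by at most mu, so the infimum of the
    residual norms is 0. It is attained, since M is bounded below and Lipschitz. *)
Lemma near_identity_surj y : exists x, M x = y.
Proof.
pose g x := hnorm (y - M x).
have g_step x : g (x + (y - M x)) <= mu * g x.
  by apply: le_trans (M_near _); rewrite /g linD// opprD addrA.
have g_inf : has_inf (range g).
  by split; [exists (g 0), 0|exists 0 => _ [x _ <-]; exact: hnorm_ge0].
have g_ge x : inf (range g) <= g x by apply: ge_inf; [case: g_inf|exists x].
have d0 : inf (range g) <= 0.
  rewrite leNgt; apply/negP => d0.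
  (* With d the infimum, one step from x with g x < d + (1 - mu) d would give d <= mu (d + (1 - mu)
     d), that is (1 - mu)^2 d <= 0. *)
  have e0 : 0 < (1 - mu) * inf (range g) by rewrite mulr_gt0// subr_gt0.
  have [_ [x _ <-] gx] := inf_adherent e0 g_inf.
  have h1 : mu * g x <= mu * (inf (range g) + (1 - mu) * inf (range g)).
    by rewrite ler_wpM2l// ltW.
  have := le_trans (g_ge _) (le_trans (g_step x) h1).
  have : 0 < (1 - mu) ^+ 2 * inf (range g).
    by rewrite mulr_gt0// exprn_gt0// subr_gt0.
  rewrite expr2; lra.
have [|||x gx] := @complete_minimizer R H g.
- move=> e e0; have [_ [x _ <-] gx] := inf_adherent e0 g_inf.
  by exists x; lra.
(* Indeed (1 - mu) |a - b| <= |M a - M b| <= g a + g b. *)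
- move=> e e0; exists ((1 - mu) * e / 2).
    by rewrite divr_gt0// mulr_gt0// subr_gt0.
  move=> a b ga gb; have m0 : 0 < 1 - mu by rewrite subr_gt0.
  rewrite -(ltr_pM2l m0); apply: (le_lt_trans (near_identity_ge _)).
  rewrite linB// -[M a - M b](_ : (y - M b) - (y - M a) = _); last first.
    by rewrite opprB addrC addrA subrK.
  by apply: (le_lt_trans (ler_hnormB _ _)); rewrite -!/(g _); lra.
(* The function g is Lipschitz with constant 1 + mu <= 2. *)
- move=> z e e0; exists (e / 2) => [|x zx]; first by rewrite divr_gt0.
  have := ler_hnormB (y - M x) (M (z - x)).
  rewrite [in X in hnorm X](_ : _ - _ - _ = y - M z); last first.
    by rewrite linB// opprB addrA subrK.
  rewrite -!/(g _).
  have := near_identity_le (z - x).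
  have : (1 + mu) * hnorm (z - x) <= 2 * hnorm (z - x).
    have mu2 : 1 + mu <= 2 by move: mu_lt1; lra.
    by rewrite ler_wpM2r ?hnorm_ge0.
  by lra.
exists x; apply/eqP; rewrite eq_sym -subr_eq0; apply/eqP/hnorm0_eq0/eqP.
by rewrite eq_le gx hnorm_ge0.
Qed.

(** The lower bound on M makes it injective, so the preimages selected by [choice] form a linear
    two-sided inverse; its two bounds are those of M read at N x. *)
Lemma near_identity_inverse :
  exists N : H -> H, inverse_operator M N /\
    forall x, (1 + mu)^-1 * hnorm x <= hnorm (N x) <= (1 - mu)^-1 * hnorm x.
Proof.
have [N NK] := choice near_identity_surj.
have m0 : 0 < 1 - mu by rewrite subr_gt0.
have N_le x : hnorm (N x) <= (1 - mu)^-1 * hnorm x.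
  by rewrite ler_pdivlMl// -{2}(NK x) near_identity_ge.
have M_inj x y : M x = M y -> x = y.
  move=> Mxy; apply/eqP; rewrite -subr_eq0; apply/eqP/hnorm0_eq0/eqP.
  rewrite eq_le hnorm_ge0 andbT -(ler_pM2l m0) mulr0.
  by apply: (le_trans (near_identity_ge _)); rewrite linB// Mxy subrr hnorm0.
exists N; split; last first.
  move=> x; rewrite N_le andbT ler_pdivrMl; last by rewrite ltr_wpDr.
  by rewrite -{1}(NK x) near_identity_le.
split=> // [x|]; first exact/M_inj/NK.
split; last by exists (1 - mu)^-1.
by move=> a x y; apply: M_inj; rewrite M_linear !NK.
Qed.

End NearIdentity.

(** * The upper frame bound of the perturbed sequence *)

Section Multiplier.
Variables (R : realType) (J : choiceType) (H : hilbertType R).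
Variable K_ : J -> hilbertType R.
Variables (L Ld G : forall j, H -> K_ j) (u : forall j, K_ j -> K_ j).
Hypothesis L_op : forall j, bounded_operator (L j).
Hypothesis Ld_op : forall j, bounded_operator (Ld j).
Hypothesis G_op : forall j, bounded_operator (G j).
Hypothesis u_op : forall j, bounded_operator (@u j).

Section UpperBound.
Variables (BL lambda : R).
Hypothesis L_upper : upper_gframe_bound L BL.
Hypothesis lambdaE :
  \esum_(j in [set: J]) (opnorm (fun x => L j x - G j x) ^+ 2)%:E = lambda%:E.

Lemma perturbed_upper_bound :
  upper_gframe_bound G (BL * (1 + Num.sqrt lambda / Num.sqrt BL) ^+ 2).
Proof.
have [BL0 L_le] := L_upper.
have lam_le : forall B : {fset J},
    \sum_(j <- B) opnorm (fun x => L j x - G j x) ^+ 2 <= lambda.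
  by apply/esum_leP; rewrite lambdaE.
have lam0 : 0 <= lambda by have := lam_le fset0; rewrite big_nil.
have D_op j : bounded_operator (fun x => L j x - G j x).
  exact: bounded_operatorB.
set b := Num.sqrt BL; set l := Num.sqrt lambda.
have b0 : 0 < b by rewrite sqrtr_gt0.
have l0 : 0 <= l by exact: sqrtr_ge0.
have bE : BL = b ^+ 2 by rewrite sqr_sqrtr// ltW.
have lE : lambda = l ^+ 2 by rewrite sqr_sqrtr.
(* In this form the bound is the square of the sum of two ell2 norms, b |x| for L and l |x| for L -
   G. *)
have -> : BL * (1 + l / b) ^+ 2 = (b + l) ^+ 2.
  by rewrite bE; field; rewrite gt_eqF.
split; first by rewrite exprn_gt0// ltr_wpDr.
move=> x; have /esum_leP Lx := L_le x; apply/esum_leP => B.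
(* Minkowski's inequality in the equivalent form
   (p + q)^2 <= (b + l) (p^2 / b + q^2 / l); for l = 0 it remains true with
   l^-1 = 0, because then q = 0. *)
have Gj j : hnorm (G j x) ^+ 2 <= (b + l) * (hnorm (L j x) ^+ 2 / b +
    l^-1 * (opnorm (fun x => L j x - G j x) ^+ 2 * hnorm x ^+ 2)).
  set o := opnorm _; have o0 : 0 <= o by exact: opnorm_ge0.
  have Gx : hnorm (G j x) <= hnorm (L j x) + o * hnorm x.
    rewrite -[G j x](subKr (L j x)); apply: (le_trans (ler_hnormB _ _)).
    by rewrite lerD2l (ler_opnorm (D_op j)).
  have := hnorm_ge0 x; have := hnorm_ge0 (L j x); have := hnorm_ge0 (G j x).
  move: Gx; set p := hnorm (L j x); set g := hnorm (G j x).
  move=> Gx g0 p0 x0.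
  have Gx2 : g ^+ 2 <= (p + o * hnorm x) ^+ 2.
    by rewrite ler_pXn2r ?nnegrE ?addr_ge0 ?mulr_ge0.
  apply: (le_trans Gx2); rewrite -exprMn; move: l0 {Gx Gx2}.
  rewrite le_eqVlt => /orP[/eqP l0|l0].
    (* The square of [o] is a one-term partial sum, hence at most lambda = 0. *)
    have -> : o = 0.
      apply/eqP; rewrite -sqrf_eq0 eq_le sqr_ge0 andbT.
      by have := lam_le [fset j]%fset; rewrite big_seq_fset1 lE -l0 expr0n.
    rewrite -l0 invr0 !mul0r !addr0 mulrCA divff ?mulr1//.
    by rewrite gt_eqF.
  rewrite -subr_ge0; set q := o * hnorm x.
  have -> : (b + l) * (p ^+ 2 / b + l^-1 * q ^+ 2) - (p + q) ^+ 2 =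
      (l * p - b * q) ^+ 2 / (b * l) by field; rewrite !gt_eqF.
  by rewrite divr_ge0 ?sqr_ge0// ltW// mulr_gt0.
apply: (le_trans (ler_sum _ (fun j _ => Gj j))).
rewrite -mulr_sumr big_split/= -mulr_suml -mulr_sumr -mulr_suml.
rewrite [(b + l) ^+ 2]expr2 -mulrA ler_wpM2l ?addr_ge0 ?(ltW b0)//.
(* The two sums contribute at most b |x|^2 and l |x|^2, which supplies the second factor b + l. *)
rewrite mulrDl lerD//.
  by rewrite ler_pdivrMr// mulrAC -expr2 -bE.
apply: (@le_trans _ _ (l^-1 * (lambda * hnorm x ^+ 2))).
  by rewrite ler_wpM2l ?invr_ge0// ler_wpM2r ?sqr_ge0.
rewrite mulrA ler_wpM2r ?sqr_ge0// lE expr2 mulrA.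
by have [->|l1] := eqVneq l 0; rewrite ?mulr0// mulVf ?mul1r.
Qed.

End UpperBound.

(** * Convergence and linearity of the multiplier, and its distance to the identity *)

Section Inverse.
Variable mu : R.
Hypothesis dual : forall x, has_sum (fun j => adjoint (L j) (Ld j x)) x.
Hypothesis muE : \esum_(j in [set: J])
  (opnorm (fun x => L j x - adjoint (@u j) (G j x)) * opnorm (Ld j))%:E = mu%:E.

Let a j := opnorm (fun x => L j x - adjoint (@u j) (G j x)).

Let a_ge0 j : 0 <= a j.
Proof.
apply/opnorm_ge0/bounded_operatorB => //; apply: bounded_operator_comp => //.
exact: adjoint_bounded.
Qed.

Let mu_le (B : {fset J}) : \sum_(j <- B) a j * opnorm (Ld j) <= mu.
Proof. by move: B; apply/esum_leP; rewrite -muE. Qed.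

Lemma multiplier_mu_ge0 : 0 <= mu.
Proof. by have := mu_le fset0; rewrite big_nil. Qed.

Let M := multiplier u G Ld.

(** The differences [d j] are absolutely summable with total at most mu |x|. Subtracting their sum
    from the dual expansion of x gives the convergence of the series, so that [usum] is its true
    sum, together with the estimate. *)
Lemma has_sum_multiplier_near x :
  has_sum (fun j => adjoint (G j) (u (Ld j x))) (M x) /\
  hnorm (x - M x) <= mu * hnorm x.
Proof.
pose d j := adjoint (L j) (Ld j x) - adjoint (G j) (u (Ld j x)).
have [j|B|s ds s_le] := @has_sum_absolute R J H d
    (fun j => a j * opnorm (Ld j) * hnorm x) (mu * hnorm x).
- apply: (le_trans (ler_hnorm_adjointB _ _ _ _)) => //.
  by rewrite -/(a j) -mulrA ler_wpM2l// ler_opnorm.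
- by rewrite -mulr_suml ler_wpM2r ?hnorm_ge0.
have Ms : has_sum (fun j => adjoint (G j) (u (Ld j x))) (x - s).
  rewrite -scaleN1r addrC.
  rewrite (_ : (fun j => _) =
      fun j => -1 *: d j + adjoint (L j) (Ld j x)); last first.
    by apply/funext => j; rewrite scaleN1r opprB subrK.
  exact: has_sum_linear.
have MxE : M x = x - s by exact: has_sum_usum.
by rewrite MxE subKr.
Qed.

Lemma multiplier_linear : linear M.
Proof.
move=> c x y; apply: has_sum_usum.
rewrite (_ : (fun j => _) = fun j => c *: adjoint (G j) (u (Ld j x)) +
    adjoint (G j) (u (Ld j y))).
  apply: has_sum_linear; first by case: (has_sum_multiplier_near x).
  by case: (has_sum_multiplier_near y).
apply/funext => j; have [Ldl _] := Ld_op j; have [ul _] := u_op j.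
by rewrite /diag /analysis Ldl ul adjoint_linear.
Qed.

(** * The lower frame bound of the perturbed sequence *)

Section LowerBound.
Variable BLd : R.
Hypothesis Ld_upper : upper_gframe_bound Ld BLd.
Hypothesis U_bounded : diag_bounded u.
Hypothesis mu_lt1 : mu < 1.
Hypothesis G_upper : exists B, upper_gframe_bound G B.

(** The weight t stays free because it is used twice: a large value shows that [diag_norm u] is
    nonzero, and a balanced one yields the constant. *)
Lemma multiplier_AMGM x (s t : R) : 0 < t ->
  (forall B : {fset J}, \sum_(j <- B) hnorm (G j x) ^+ 2 <= s) ->
  2 * (1 - mu) * hnorm x ^+ 2 <=
    t * (diag_norm u ^+ 2 * BLd * hnorm x ^+ 2) + t^-1 * s.
Proof.
move=> t0 Gs; have [BLd0 Ld_le] := Ld_upper.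
have [Mx xMx] := has_sum_multiplier_near x.
have c0 : 0 <= Num.sqrt BLd * hnorm x by rewrite mulr_ge0 ?sqrtr_ge0 ?hnorm_ge0.
have BE : BLd * hnorm x ^+ 2 = (Num.sqrt BLd * hnorm x) ^+ 2.
  by rewrite exprMn sqr_sqrtr ?ltW.
have [Ldx2 Ldx] : ell2 (analysis Ld x) /\
    ell2_norm (analysis Ld x) <= Num.sqrt BLd * hnorm x.
  by apply/ell2_leP => //; rewrite -BE; exact/esum_leP/Ld_le.
set c := (X in _ <= X).
have Mxx : 2 * rdot (M x) x <= c.
  have k0 : 0 <= 2 * hnorm x by rewrite mulr_ge0 ?hnorm_ge0.
  apply: (@has_sum_le _ _ _ _ _ (fun y => 2 * rdot y x) _ _ Mx k0) => [y z|B].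
    rewrite -{1}[y](subrK z) rdotDl; have := rdot_le (y - z) x; lra.
  rewrite rdot_suml mulr_sumr.
  apply: (@le_trans _ _ (\sum_(j <- B) (t * hnorm (u (Ld j x)) ^+ 2 +
      t^-1 * hnorm (G j x) ^+ 2))).
    apply: ler_sum => j _; rewrite rdotC -rdot_adjoint// rdotC.
    exact: rdot_AMGM.
  rewrite big_split/= -!mulr_sumr /c; apply: lerD; last first.
    by rewrite ler_wpM2l ?invr_ge0 ?(ltW t0).
  rewrite ler_wpM2l ?(ltW t0)// -mulrA BE -exprMn.
  have ul j : linear (@u j) by case: (u_op j).
  exact: (diag_sum_le ul U_bounded B c0 Ldx2 Ldx).
(* Here Re <M x, x> = |x|^2 - Re <x - M x, x> >= (1 - mu) |x|^2. *)
apply: le_trans Mxx; have := rdot_le (x - M x) x; rewrite rdotDl rdotNl rdotxx.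
have : hnorm (x - M x) * hnorm x <= mu * hnorm x * hnorm x.
  by rewrite ler_wpM2r ?hnorm_ge0.
by rewrite expr2; lra.
Qed.

(** A nonzero vector forces U to be nonzero. In the zero space [diag_norm u] may vanish, and as the
    inverse of 0 is 0 the stated bound would then not be positive. *)
Lemma multiplier_lower_bound : (exists x : H, x != 0) ->
  lower_gframe_bound G ((diag_norm u ^+ 2 * BLd)^-1 * (1 - mu) ^+ 2).
Proof.
move=> [x0 x0_neq0]; have [BLd0 _] := Ld_upper.
have m0 : 0 < 1 - mu by rewrite subr_gt0.
have ul j : linear (@u j) by case: (u_op j).
set k := diag_norm u ^+ 2 * BLd.
have k0 : 0 <= k by rewrite mulr_ge0 ?sqr_ge0 ?ltW.
have [BG [BG0 G_le]] := G_upper.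
have G_sum x : exists2 s, 0 <= s &
    \esum_(j in [set: J]) (hnorm (G j x) ^+ 2)%:E = s%:E.
  have : (0 <= \esum_(j in [set: J]) (hnorm (G j x) ^+ 2)%:E)%E.
    by apply: esum_ge0 => j _; rewrite lee_fin sqr_ge0.
  by have := G_le x; case: esum => [s||]// _; exists s.
have AMGM x s t : 0 < t ->
    \esum_(j in [set: J]) (hnorm (G j x) ^+ 2)%:E = s%:E ->
    2 * (1 - mu) * hnorm x ^+ 2 <= t * (k * hnorm x ^+ 2) + t^-1 * s.
  by move=> t0 sE; apply: multiplier_AMGM => //; apply/esum_leP; rewrite sE.
have {}k0 : 0 < k.
  rewrite lt_neqAle k0 andbT; apply/eqP => k0'.
  have [s s0 sE] := G_sum x0.
  pose m := (1 - mu) * hnorm x0 ^+ 2.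
  have m_gt0 : 0 < m by rewrite mulr_gt0// exprn_gt0// hnorm_gt0.
  (* If k were 0, this weight would give 2 m <= m s / (s + 1) < m. *)
  have t0 : 0 < (s + 1) / m by rewrite divr_gt0// ltr_wpDl.
  have := AMGM x0 s _ t0 sE; rewrite -k0' mul0r mulr0 add0r -mulrA -/m.
  rewrite invf_div mulrAC ler_pdivlMr ?ltr_wpDl//.
  have : 0 <= m * s by rewrite mulr_ge0// ltW.
  by move: m_gt0; rewrite mulrDr; lra.
split; first by rewrite mulr_gt0 ?invr_gt0// exprn_gt0.
move=> x; have [s s0 sE] := G_sum x; rewrite sE lee_fin.
(* This weight makes the first term on the right exactly half of the left-hand side, leaving m X <=
   (k / m) s. *)
have t0 : 0 < (1 - mu) / k by rewrite divr_gt0.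
have := AMGM x s _ t0 sE; set X := hnorm x ^+ 2; set m := 1 - mu in m0 t0 *.
have -> : m / k * (k * X) = m * X by field; rewrite gt_eqF.
have -> : k^-1 * m ^+ 2 * X = m / k * (m * X) by field; rewrite gt_eqF.
move=> h; have {h} : m * X <= (m / k)^-1 * s by lra.
by rewrite ler_pdivlMl.
Qed.

End LowerBound.

End Inverse.

End Multiplier.

Theorem theorem3p4 (R : realType) (H K : hilbertType R)
  (Hsep : separable H) (Ksep : separable K)
  (I : set int) (K_ : I -> closedSubspace K)
  (Lambda Lambdad Gamma : forall i : I, H -> K_ i)
  (u : forall i : I, K_ i -> K_ i)
  (BL BLd lambda mu : R)
  (LambdaF : gframe Lambda) (LambdaB : upper_gframe_bound Lambda BL)
  (LambdadF : dual_gframe Lambda Lambdad)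
  (LambdadB : upper_gframe_bound Lambdad BLd)
  (u_op : forall i, bounded_operator (u i)) (U_bounded : diag_bounded u)
  (Gamma_op : forall i, bounded_operator (Gamma i))
  (lambdaE : \esum_(i in [set: I])
     (opnorm (fun x => Lambda i x - Gamma i x) ^+ 2)%:E = lambda%:E)
  (muE : \esum_(i in [set: I])
     (opnorm (fun x => Lambda i x - adjoint (u i) (Gamma i x))
        * opnorm (Lambdad i))%:E = mu%:E)
  (mu_lt1 : mu < 1) :
  let M := multiplier u Gamma Lambdad in
  [/\ gframe Gamma,
      (exists x : H, x != 0) ->
        lower_gframe_bound Gamma ((diag_norm u ^+ 2 * BLd)^-1 * (1 - mu) ^+ 2),
      upper_gframe_bound Gamma
        (BL * (1 + Num.sqrt lambda / Num.sqrt BL) ^+ 2),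
      (forall x, has_sum (fun i => adjoint (Gamma i) (u i (Lambdad i x))) (M x))
        /\ bounded_operator M &
      exists N : H -> H, inverse_operator M N /\
        forall x, (1 + mu)^-1 * hnorm x <= hnorm (N x) <= (1 - mu)^-1 * hnorm x].
Proof.
move=> M.
have [Lambda_op _ _] := LambdaF; have [[Lambdad_op _ _] dual] := LambdadF.
have G_upper := perturbed_upper_bound Lambda_op Gamma_op LambdaB lambdaE.
have G_lower := multiplier_lower_bound Lambda_op Lambdad_op Gamma_op u_op
  dual muE LambdadB U_bounded mu_lt1 (ex_intro _ _ G_upper).
have M_near := has_sum_multiplier_near Lambda_op Lambdad_op Gamma_op u_op dual muE.
have M_linear : linear M :=
  multiplier_linear Lambda_op Lambdad_op Gamma_op u_op dual muE.
have mu_ge0 : 0 <= mu := multiplier_mu_ge0 muE.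
split=> //.
- split=> //; last by eexists; exact: G_upper.
  have [H0|H0] := pselect (exists x : H, x != 0).
    by eexists; exact: G_lower.
  (* In the zero space every positive constant is a lower bound. *)
  exists 1; split=> // x; have -> : x = 0.
    by apply/eqP; apply/negPn/negP => x0; apply: H0; exists x.
  by rewrite hnorm0 expr0n mulr0; apply: esum_ge0 => j _; rewrite lee_fin sqr_ge0.
- split; first by move=> x; case: (M_near x).
  split=> //; exists (1 + mu) => x.
  by apply: near_identity_le => y; case: (M_near y).
- by apply: near_identity_inverse => // x; case: (M_near x).
Qed.
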